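(* Let $(T_n)_{n\ge0}$ be a sequence of regular interval exchange transformations such that, for every $n\ge0$, $T_{n+1}=\varphi(T_n)$ or $T_{n+1}=\psi(T_n)$. Then the length of the domain of $T_n$ tends to $0$ as $n\to\infty$.
   Context: An $s$-interval exchange transformation $T$ on $[\ell,r[$ over a finite alphabet $A=\{a_1<_1\cdots<_1a_s\}$ equipped also with a second total order $<_2$ is given by a partition $(I_a)_{a\in A}$ of $[\ell,r[$ into semi-intervals $I_a=[\gamma_a,\mu_a[$ (sets $[\alpha,\beta[=\{z:\alpha\le z<\beta\}$) of lengths $\lambda_a>0$ placed left to right in the order $<_1$; with $\nu_a=\ell+\sum_{b\le_2a}\lambda_b$, $T(z)=z+\nu_a-\mu_a$ on $I_a$, mapping $I_a$ onto $J_a=[\delta_a,\nu_a[$. $T$ is regular if the orbits of $\gamma_{a_2},\dots,\gamma_{a_s}$ are infinite and pairwise disjoint; regular implies minimal. For minimal $T$ and a semi-interval $I$, the induced transformation on $I$ is $S(z)=T^n(z)$, $n=\min\{n>0:T^n(z)\in I\}$. With $b_{\max},b_{\min}$ the $<_2$-largest/smallest letters, the right Rauzy induction $\psi(T)$ is the transformation induced by $T$ on $Z(T)=[\ell,\max\{\gamma_{a_s},\delta_{b_{\max}}\}[$ and the left Rauzy induction $\varphi(T)$ is the one induced on $Y(T)=[\min\{\mu_{a_1},\nu_{b_{\min}}\},r[$; each is again a regular $s$-interval exchange transformation on its domain. *)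

(* Defs.v *)
From HB Require Import structures.
From mathcomp Require Import all_boot all_order all_algebra.
From mathcomp Require Import all_classical all_reals all_analysis.

Set Implicit Arguments.
Unset Strict Implicit.
Unset Printing Implicit Defensive.

Import Order.TTheory GRing.Theory Num.Theory.
Import numFieldNormedType.Exports.

Local Open Scope classical_set_scope.
Local Open Scope ring_scope.

(* The orders are given by their reflexive versions: [le1 a b] is a <=_1 b.
   The number s of intervals is #|A|. *)
Record iet (R : realType) (A : finType) := Iet {
  iet_card : (0 < #|A|)%N;
  le1 : rel A;
  le1_total : total le1;
  le1_anti : antisymmetric le1;
  le1_trans : transitive le1;
  le2 : rel A;
  le2_total : total le2;
  le2_anti : antisymmetric le2;
  le2_trans : transitive le2;
  ell : R;
  lam : A -> R;
  lam_gt0 : forall a, 0 < lam a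
}.

Section Iet.
Variables (R : realType) (A : finType).
Implicit Types (T : iet R A) (a b : A) (z w : R) (I : set R).

Definition least_letter T (le : rel A) : A :=
  odflt (enum_val (Ordinal (iet_card T))) [pick a | [forall b, le a b]].
Definition greatest_letter T (le : rel A) : A :=
  odflt (enum_val (Ordinal (iet_card T))) [pick a | [forall b, le b a]].

Definition first1 T : A := least_letter T (le1 T).
Definition last1 T : A := greatest_letter T (le1 T).
Definition first2 T : A := least_letter T (le2 T).
Definition last2 T : A := greatest_letter T (le2 T).

Definition right_end T : R := ell T + \sum_a lam T a.
Definition domain T : set R := `[ell T, right_end T[.
Definition domain_length T : R := right_end T - ell T.

Definition mu T a : R := ell T + \sum_(b | le1 T b a) lam T b.
Definition gamma T a : R := mu T a - lam T a.
Definition nu T a : R := ell T + \sum_(b | le2 T b a) lam T b.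
Definition delta T a : R := nu T a - lam T a.

(* The letter a with z in I_a = [gamma_a, mu_a[; [None] outside the domain. *)
Definition letter T z : option A := [pick a | z \in `[gamma T a, mu T a[ ].

(* Extended by the identity outside the domain. *)
Definition iet_map T z : R :=
  if letter T z is Some a then z + nu T a - mu T a else z.

(* The two-sided orbit {T^n z | n in Z}: T is a bijection of its domain, so
   T^(-n) z is the w in the domain with T^n w = z. *)
Definition iet_orbit T z : set R :=
  [set w | domain T w /\
     exists n, iter n (iet_map T) z = w \/ iter n (iet_map T) w = z].

Definition regular T : Prop :=
  (forall a, a != first1 T -> infinite_set (iet_orbit T (gamma T a))) /\
  (forall a b, a != first1 T -> b != first1 T -> a != b ->
     iet_orbit T (gamma T a) `&` iet_orbit T (gamma T b) = set0).

Definition first_return T I z (n : nat) : Prop :=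
  [/\ (0 < n)%N, I (iter n (iet_map T) z) &
      forall k, (0 < k < n)%N -> ~ I (iter k (iet_map T) z)].

(* The letters of z, T z, ..., T^(n-1) z. *)
Definition itinerary T z (n : nat) : seq (option A) :=
  [seq letter T w | w <- traject (iet_map T) z n].

Definition Zdom T : set R :=
  `[ell T, Num.max (gamma T (last1 T)) (delta T (last2 T))[.
Definition Ydom T : set R :=
  `[Num.min (mu T (first1 T)) (nu T (first2 T)), right_end T[.

End Iet.

(* [T'] is the transformation induced by [T] on [I], as an interval exchange
   transformation up to renaming of the letters. The map alone does not
   determine its partition, since the map may be continuous at some gamma_a;
   the intervals exchanged by the induced transformation are the sets of points
   of [I] with a given sequence of letters up to the first return to [I]. *)
Definition is_induced (R : realType) (A A' : finType)
    (T : iet R A) (I : set R) (T' : iet R A') : Prop :=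
  [/\ domain T' = I,
      forall z, I z -> exists n,
        first_return T I z n /\ iet_map T' z = iter n (iet_map T) z &
      forall z w m n, I z -> I w ->
        first_return T I z m -> first_return T I w n ->
        (letter T' z = letter T' w <-> itinerary T z m = itinerary T w n)].

Definition is_psi (R : realType) (A A' : finType)
    (T : iet R A) (T' : iet R A') : Prop := is_induced T (Zdom T) T'.
Definition is_phi (R : realType) (A A' : finType)
    (T : iet R A) (T' : iet R A') : Prop := is_induced T (Ydom T) T'.

(* Main.v *)
(* An induction step removes from the domain of T the shorter of two
   semi-intervals I_a, J_b at one of its ends, so T' has at most as many letters
   as T, its letters refine those of T, and T' differs from T only on points
   lying, for T', in a subinterval no longer than the removed piece. If the
   domains shrink to J = [l, r[ with l < r, the partitions of J by letters refine
   each other while their number of classes is bounded, so they stabilize; as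
   the removed lengths tend to 0, the maps T_n eventually coincide on J, which is
   then invariant under some T_n. The boundary of an invariant proper
   semi-interval yields a connection between discontinuities of T_n and of its
   inverse, which regularity excludes. *)
Require Import Defs.
From HB Require Import structures.
From mathcomp Require Import all_boot all_order all_algebra.
From mathcomp Require Import all_classical all_reals all_analysis.
From mathcomp Require Import lra.

Set Implicit Arguments.
Unset Strict Implicit.
Unset Printing Implicit Defensive.

Import Order.TTheory GRing.Theory Num.Theory.
Import numFieldNormedType.Exports.

Local Open Scope classical_set_scope.
Local Open Scope ring_scope.

(** * Prefix sums of positive lengths along a total order *)

Section PrefixSums.
Variables (R : realType) (A : finType) (le : rel A) (lam : A -> R).
Hypothesis le_total : total le.
Hypothesis le_anti : antisymmetric le.
Hypothesis le_trans : transitive le.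
Hypothesis lam_gt0 : forall a, 0 < lam a.

Let pos a := \sum_(b | le b a) lam b.

(** By transitivity every term of [pos a] occurs in [pos b], which has the further term [lam b].
    This is what makes distinct subintervals disjoint. *)
Lemma prefix_sum_gap a b : ~~ le b a -> pos a + lam b <= pos b.
Proof.
move=> nba; have ab : le a b by case/orP: (le_total a b) nba => // ->.
rewrite /pos (bigD1 (P := fun c => le c b) b) /=; last first.
  by case/orP: (le_total b b).
rewrite [leRHS]addrC lerD2r [leLHS]big_mkcond [leRHS]big_mkcond /=; apply: ler_sum => c _.
case: ifP => ca; last by case: ifP => // _; exact: ltW.
rewrite (le_trans ca ab) /=; case: eqP => // cb.
by move: ca nba; rewrite cb => ->.
Qed.

Lemma prefix_sum_le a b : (pos a <= pos b) = le a b.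
Proof.
apply/idP/idP => [|ab].
  apply: contraTT => /prefix_sum_gap h; rewrite -ltNge.
  by apply: lt_le_trans h; rewrite ltrDl.
rewrite /pos [leLHS]big_mkcond [leRHS]big_mkcond /=; apply: ler_sum => c _.
case: ifP => ca; last by case: ifP => // _; exact: ltW.
by rewrite (le_trans ca ab).
Qed.

Lemma prefix_sum_ge a : lam a <= pos a.
Proof.
rewrite /pos (bigD1 a) /=; last by case/orP: (le_total a a).
by rewrite lerDl sumr_ge0 // => b _; exact: ltW.
Qed.

Lemma prefix_sum_total a : pos a <= \sum_b lam b.
Proof.
rewrite /pos [leLHS]big_mkcond; apply: ler_sum => b _.
by case: ifP => // _; exact: ltW.
Qed.

Lemma exists_greatest (a0 : A) : [exists a, [forall b, le b a]].
Proof.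
apply/existsP; case: (arg_maxP pos (isT : xpredT a0)) => a _ h.
by exists a; apply/forallP => b; rewrite -prefix_sum_le; exact: h.
Qed.

Lemma exists_least (a0 : A) : [exists a, [forall b, le a b]].
Proof.
apply/existsP; case: (arg_minP pos (isT : xpredT a0)) => a _ h.
by exists a; apply/forallP => b; rewrite -prefix_sum_le; exact: h.
Qed.

Lemma prefix_sum_greatest a : (forall b, le b a) -> pos a = \sum_b lam b.
Proof. by move=> h; apply: eq_bigl => b; rewrite h. Qed.

Lemma prefix_sum_least a : (forall b, le a b) -> pos a = lam a.
Proof.
move=> h; rewrite /pos (big_pred1 a) // => b /=.
by apply/idP/eqP => [ba|->//]; apply: le_anti; rewrite ba h.
Qed.

(** The letter with the least prefix sum above [x] works: were [x] below its left end, the preceding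
    letter would already have a prefix sum above [x]. *)
Lemma prefix_sum_cover x : 0 <= x -> x < \sum_b lam b ->
  exists a, pos a - lam a <= x < pos a.
Proof.
move=> x0 xs.
have [a0] : exists a, x < pos a.
  have /card_gt0P[a1 _] : (0 < #|A|)%N.
    rewrite lt0n; apply: contraTN xs => /eqP A0.
    by rewrite -leNgt big_pred0 // => a; have := card0_eq A0 a; rewrite !inE.
  have /existsP[a /forallP ha] := exists_greatest a1.
  by exists a; rewrite prefix_sum_greatest.
move=> h0; case: (arg_minP pos (h0 : [pred a | x < pos a] a0)) => a /= xa mina.
exists a; rewrite xa andbT leNgt; apply/negP => xlt.
have posE : pos a - lam a = \sum_(b | le b a && (b != a)) lam b.
  rewrite /pos (bigD1 (P := fun c => le c a) a) /=; first lra.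
  by case/orP: (le_total a a).
have [b0 hb0] : exists b, le b a && (b != a).
  apply/existsP; apply: contraTT xlt => /existsPn h.
  by rewrite posE big_pred0 -?leNgt // => b; apply/negbTE/h.
case: (arg_maxP pos (hb0 : [pred b | le b a && (b != a)] b0)) => b /= /andP[ba nba] maxb.
have : x < pos b.
  apply: lt_le_trans xlt _; rewrite posE /pos [leLHS]big_mkcond [leRHS]big_mkcond.
  apply: ler_sum => c _; case: ifP => hc; last by case: ifP => // _; exact: ltW.
  by rewrite -prefix_sum_le (maxb _ hc).
move=> /mina; rewrite prefix_sum_le => ab.
by move: nba; rewrite (@le_anti b a) ?ab ?ba ?eqxx.
Qed.

End PrefixSums.

(** * Subintervals, their images, and bijectivity of the exchange *)

Section IetBasics.
Variables (R : realType) (A : finType) (T : iet R A).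
Implicit Types (a b c : A) (z w : R).

Lemma greatest_letterP (le : rel A) : total le -> antisymmetric le ->
  transitive le -> forall b, le b (greatest_letter T le).
Proof.
move=> h1 h2 h3; rewrite /greatest_letter; case: pickP => [a /forallP//|h].
have /existsP[a ha] := exists_greatest h1 h3 (lam_gt0 T)
  (enum_val (Ordinal (iet_card T))).
by rewrite h in ha.
Qed.

Lemma least_letterP (le : rel A) : total le -> antisymmetric le ->
  transitive le -> forall b, le (least_letter T le) b.
Proof.
move=> h1 h2 h3; rewrite /least_letter; case: pickP => [a /forallP//|h].
have /existsP[a ha] := exists_least h1 h3 (lam_gt0 T)
  (enum_val (Ordinal (iet_card T))).
by rewrite h in ha.
Qed.

Let le1P := And3 (@le1_total _ _ T) (@le1_anti _ _ T) (@le1_trans _ _ T).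
Let le2P := And3 (@le2_total _ _ T) (@le2_anti _ _ T) (@le2_trans _ _ T).

Lemma mu_last1 : mu T (last1 T) = right_end T.
Proof.
by rewrite /mu prefix_sum_greatest //; case: le1P; exact: greatest_letterP.
Qed.

Lemma nu_last2 : nu T (last2 T) = right_end T.
Proof.
by rewrite /nu prefix_sum_greatest //; case: le2P; exact: greatest_letterP.
Qed.

Lemma gamma_first1 : gamma T (first1 T) = ell T.
Proof.
rewrite /gamma /mu prefix_sum_least ?addrK //; first exact: le1_anti.
by case: le1P; exact: least_letterP.
Qed.

Lemma delta_first2 : delta T (first2 T) = ell T.
Proof.
rewrite /delta /nu prefix_sum_least ?addrK //; first exact: le2_anti.
by case: le2P; exact: least_letterP.
Qed.

Lemma gamma_lt_mu a : gamma T a < mu T a.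
Proof. by rewrite gtrBl lam_gt0. Qed.

Lemma delta_lt_nu a : delta T a < nu T a.
Proof. by rewrite gtrBl lam_gt0. Qed.

Lemma ell_le_gamma a : ell T <= gamma T a.
Proof.
rewrite /gamma /mu; have := prefix_sum_ge (@le1_total _ _ T) (lam_gt0 T) a; lra.
Qed.

Lemma ell_le_delta a : ell T <= delta T a.
Proof.
rewrite /delta /nu; have := prefix_sum_ge (@le2_total _ _ T) (lam_gt0 T) a; lra.
Qed.

Lemma mu_le_right_end a : mu T a <= right_end T.
Proof. by rewrite lerD2l prefix_sum_total //; exact: lam_gt0. Qed.

Lemma nu_le_right_end a : nu T a <= right_end T.
Proof. by rewrite lerD2l prefix_sum_total //; exact: lam_gt0. Qed.

Lemma ell_lt_right_end : ell T < right_end T.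
Proof.
have := ell_le_gamma (first1 T); have := gamma_lt_mu (first1 T).
have := mu_le_right_end (first1 T); lra.
Qed.

Lemma subinterval_uniq a b z :
  gamma T a <= z < mu T a -> gamma T b <= z < mu T b -> a = b.
Proof.
move=> /andP[a1 a2] /andP[b1 b2].
have wlog_le c d : gamma T d <= z -> z < mu T c -> Defs.le1 T d c.
  move=> hd hc; apply/negPn/negP => /(prefix_sum_gap (@le1_total _ _ T)
    (@le1_trans _ _ T) (lam_gt0 T)); move: hd hc; rewrite /gamma /mu; lra.
by apply: (@le1_anti _ _ T); rewrite !wlog_le.
Qed.

Lemma image_subinterval_uniq a b z :
  delta T a <= z < nu T a -> delta T b <= z < nu T b -> a = b.
Proof.
move=> /andP[a1 a2] /andP[b1 b2].
have wlog_le c d : delta T d <= z -> z < nu T c -> le2 T d c.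
  move=> hd hc; apply/negPn/negP => /(prefix_sum_gap (@le2_total _ _ T)
    (@le2_trans _ _ T) (lam_gt0 T)); move: hd hc; rewrite /delta /nu; lra.
by apply: (@le2_anti _ _ T); rewrite !wlog_le.
Qed.

Lemma domainE z : domain T z = (ell T <= z < right_end T) :> Prop.
Proof. by rewrite /domain /= in_itv. Qed.

Lemma subinterval_domain a z : gamma T a <= z < mu T a -> domain T z.
Proof.
rewrite domainE => /andP[h1 h2]; have := ell_le_gamma a.
have := mu_le_right_end a; move=> *; apply/andP; split; lra.
Qed.

Lemma image_subinterval_domain a z : delta T a <= z < nu T a -> domain T z.
Proof.
rewrite domainE => /andP[h1 h2]; have := ell_le_delta a.
have := nu_le_right_end a; move=> *; apply/andP; split; lra.
Qed.

Lemma gamma_subinterval a : gamma T a <= gamma T a < mu T a.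
Proof. by rewrite lexx gamma_lt_mu. Qed.

Lemma gamma_domain a : domain T (gamma T a).
Proof. exact: subinterval_domain (gamma_subinterval a). Qed.

Lemma subinterval_cover z : domain T z -> exists a, gamma T a <= z < mu T a.
Proof.
rewrite domainE /right_end => /andP[h1 h2].
have [||a /andP[h3 h4]] := prefix_sum_cover (@le1_total _ _ T)
  (@le1_anti _ _ T) (@le1_trans _ _ T) (lam_gt0 T) (x := z - ell T); try lra.
by exists a; rewrite /gamma /mu; apply/andP; split; lra.
Qed.

Lemma image_subinterval_cover z :
  domain T z -> exists a, delta T a <= z < nu T a.
Proof.
rewrite domainE /right_end => /andP[h1 h2].
have [||a /andP[h3 h4]] := prefix_sum_cover (@le2_total _ _ T)
  (@le2_anti _ _ T) (@le2_trans _ _ T) (lam_gt0 T) (x := z - ell T); try lra.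
by exists a; rewrite /delta /nu; apply/andP; split; lra.
Qed.

Lemma letterP a z : letter T z = Some a <-> gamma T a <= z < mu T a.
Proof.
rewrite /letter; case: pickP => [b|h].
  rewrite in_itv /= => hb; split => [[<-]//|ha].
  by rewrite (subinterval_uniq ha hb).
by split=> // ha; have := h a; rewrite in_itv /= ha.
Qed.

Lemma iet_mapE a z :
  gamma T a <= z < mu T a -> iet_map T z = z + nu T a - mu T a.
Proof. by move=> /letterP; rewrite /iet_map => ->. Qed.

Lemma iet_map_image a z : gamma T a <= z < mu T a ->
  delta T a <= iet_map T z < nu T a.
Proof.
move=> h; rewrite (iet_mapE h); move: h => /andP[]; rewrite /gamma /delta.
move=> *; apply/andP; split; lra.
Qed.

Lemma iet_map_domain z : domain T z -> domain T (iet_map T z).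
Proof.
by move=> /subinterval_cover[a /iet_map_image]; exact: image_subinterval_domain.
Qed.

Lemma iet_map_image_inv a z : domain T z ->
  delta T a <= iet_map T z < nu T a -> gamma T a <= z < mu T a.
Proof.
move=> /subinterval_cover[b hb] ha.
by rewrite (image_subinterval_uniq ha (iet_map_image hb)).
Qed.

Lemma iet_map_inj z w : domain T z -> domain T w ->
  iet_map T z = iet_map T w -> z = w.
Proof.
move=> dz dw e; have [a ha] := subinterval_cover dz.
have hw : gamma T a <= w < mu T a.
  by apply: iet_map_image_inv => //; rewrite -e; exact: iet_map_image.
move: e; rewrite (iet_mapE ha) (iet_mapE hw); lra.
Qed.

Lemma iet_map_surj z : domain T z -> exists2 w, domain T w & iet_map T w = z.
Proof.
move=> /image_subinterval_cover[a /andP[h1 h2]].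
have h : gamma T a <= z - nu T a + mu T a < mu T a.
  by move: h1; rewrite /gamma /delta => *; apply/andP; split; lra.
exists (z - nu T a + mu T a); first exact: subinterval_domain h.
by rewrite (iet_mapE h); lra.
Qed.

Lemma iet_map_gamma a : iet_map T (gamma T a) = delta T a.
Proof.
by rewrite (@iet_mapE a) ?lexx ?gamma_lt_mu // /gamma /delta; lra.
Qed.

Lemma letter_eq_map z w : domain T z -> letter T z = letter T w ->
  iet_map T z - z = iet_map T w - w.
Proof.
move=> /subinterval_cover[a ha] e.
have hw : gamma T a <= w < mu T a by apply/letterP; rewrite -e; apply/letterP.
by rewrite (iet_mapE ha) (iet_mapE hw); lra.
Qed.

End IetBasics.

(** * Dynamical consequences of regularity *)

Section Regular.
Variables (R : realType) (A : finType) (T : iet R A).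
Hypothesis regT : regular T.
Implicit Types (a b c d : A) (p q z w x : R).

(** Injectivity leaves a fixed point no other iterated preimage, so its two-sided orbit is
    finite. *)
Lemma iter_fixed_inv n p w : domain T p -> domain T w ->
  iet_map T p = p -> iter n (iet_map T) w = p -> w = p.
Proof.
move=> dp + Tp; elim: n w => [//|n IH] w dw; rewrite iterSr => /(IH _ (iet_map_domain dw)).
by move=> e; apply: (iet_map_inj dw dp); rewrite e Tp.
Qed.

(** Equality would mean that [T] maps gamma_c to gamma_d: two orbits meet if [c] and [d] differ, and
    otherwise gamma_c is fixed and has a finite orbit. *)
Lemma regular_no_connection c d :
  c != first1 T -> d != first1 T -> delta T c != gamma T d.
Proof.
move=> c1 d1; apply/eqP => e; case: regT => inf disj.
have Tc : iet_map T (gamma T c) = gamma T d by rewrite iet_map_gamma.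
have [cd|cd] := eqVneq c d; last first.
  have := disj _ _ c1 d1 cd; rewrite -subset0 => /(_ (gamma T d)); apply.
  split; split; try exact: gamma_domain.
    by exists 1%N; left.
  by exists 0%N; left.
subst d; apply: (inf c c1); apply: (@sub_finite_set _ _ [set gamma T c]) => // w.
move=> [dw [n [<-|]]]; first by elim: n => [//|n /= ->].
by apply: iter_fixed_inv => //; exact: gamma_domain.
Qed.

Lemma subinterval_after_first1 c : c != first1 T -> mu T (first1 T) <= gamma T c.
Proof.
move=> c1; rewrite leNgt; apply/negP => h; move/eqP: c1; apply.
apply: (@subinterval_uniq _ _ T _ _ (gamma T c)).
  exact: gamma_subinterval.
by rewrite gamma_first1 ell_le_gamma.
Qed.

(* If the fixed point lies in the first subinterval, that subinterval is both
   first for [<=_1] and for [<=_2], and the letters coming second in the two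
   orders give a connection. *)
Lemma regular_no_fixed_point p : (exists c, c != first1 T) ->
  domain T p -> iet_map T p != p.
Proof.
move=> [c1 hc1] dp; apply/eqP => Tp.
have [c hc] := subinterval_cover dp.
have cc : delta T c = gamma T c.
  by move: Tp; rewrite (iet_mapE hc) /gamma /delta; lra.
have [ec|nc] := eqVneq c (first1 T); last first.
  by have /eqP := regular_no_connection nc nc.
subst c; have munu : mu T (first1 T) = nu T (first1 T).
  by move: cc; rewrite /gamma /delta; lra.
have dmu : domain T (mu T (first1 T)).
  rewrite domainE; have := subinterval_after_first1 hc1.
  have := gamma_lt_mu T c1; have := mu_le_right_end T c1.
  have := gamma_lt_mu T (first1 T); rewrite gamma_first1.
  by move=> *; apply/andP; split; lra.
have [d /andP[d1 d2]] := subinterval_cover dmu.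
have [e /andP[e1 e2]] := image_subinterval_cover dmu.
have nd : d != first1 T by apply: contraTneq d2 => ->; rewrite ltxx.
have ne : e != first1 T by apply: contraTneq e2 => ->; rewrite munu ltxx.
have /eqP := regular_no_connection ne nd; apply.
have := subinterval_after_first1 nd.
have : nu T (first1 T) <= delta T e; last lra.
rewrite leNgt; apply/negP => h; move/eqP: ne; apply.
apply: (@image_subinterval_uniq _ _ T _ _ (delta T e)).
  by rewrite lexx delta_lt_nu.
by rewrite h andbT cc gamma_first1 ell_le_delta.
Qed.

(* The left end [p] of the invariant semi-interval would have to be some
   gamma_c as well as some T(gamma_d), with c and d different from the first
   letter. *)
Lemma regular_no_invariant_subinterval p q : (exists c, c != first1 T) ->
  ell T < p -> p < q -> q <= right_end T ->
  (forall z, domain T z -> (p <= z < q) = (p <= iet_map T z < q)) -> False.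
Proof.
move=> nt lp pq qr inv.
have dp : domain T p by rewrite domainE; apply/andP; split; lra.
have Tp : p <= iet_map T p < q by rewrite -inv // lexx.
have [c hc] := subinterval_cover dp.
have := regular_no_fixed_point nt dp; rewrite neq_lt ltNge.
case/andP: (Tp) => -> Tpq /= pTp.
have gc : gamma T c = p.
  apply/eqP; rewrite eq_le; case/andP: (hc) => -> hmu /=.
  rewrite leNgt; apply/negP => gp.
  (* A point left of [p] in the same subinterval, so close to [p] that the positive displacement
     [iet_map T p - p] carries it into [[p, q[]. *)
  pose x := Num.max (gamma T c) (p - (iet_map T p - p)).
  have xp : x < p by rewrite gt_max gp /=; lra.
  have x1 : gamma T c <= x by rewrite le_max lexx.
  have x2 : p - (iet_map T p - p) <= x by rewrite le_max lexx orbT.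
  have hx : gamma T c <= x < mu T c by apply/andP; split; lra.
  have /andP[px _] : p <= x < q; last by lra.
  rewrite (inv _ (subinterval_domain hx)) (iet_mapE hx).
  by move: x2 Tpq; rewrite (iet_mapE hc) => *; apply/andP; split; lra.
have nc : c != first1 T.
  by apply: contraTneq lp => e; rewrite -gc e gamma_first1 ltxx.
have [w dw Tw] := iet_map_surj dp.
have /andP[pw wq] : p <= w < q by rewrite inv // Tw lexx.
have [d hd] := subinterval_cover dw.
have nd : d != first1 T.
  apply/eqP => ed; have := subinterval_after_first1 nc; rewrite -ed gc.
  by case/andP: hd => _ *; lra.
have [gw|gw] := eqVneq (gamma T d) w.
  by have /eqP := regular_no_connection nd nc; rewrite -iet_map_gamma gw Tw gc.
have wp : p < w.
  rewrite lt_neqAle pw andbT; apply/eqP => e.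
  by have /eqP := regular_no_fixed_point nt dw; rewrite Tw.
(* A point of [[p, q[] left of [w] in the same subinterval; its image falls left of [p]. *)
pose x := Num.max (gamma T d) p.
case/andP: (hd) => hd1 hd2.
have xw : x < w by rewrite gt_max wp lt_neqAle gw hd1.
have x1 : gamma T d <= x by rewrite le_max lexx.
have x2 : p <= x by rewrite le_max lexx orbT.
have hx : gamma T d <= x < mu T d by apply/andP; split; lra.
have : p <= x < q by apply/andP; split; lra.
rewrite (inv _ (subinterval_domain hx)) (iet_mapE hx).
by move: Tw; rewrite (iet_mapE hd) => Tw /andP[h _]; lra.
Qed.

End Regular.

(* The semi-interval [x, y[ removed from the domain by an induction step: it is
   the shorter of I_a and J_b, where a, b are the last letters of the two orders
   (right induction) or the first ones (left induction). *)
Definition removes (R : realType) (A A' : finType) (T : iet R A)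
    (T' : iet R A') (a b : A) (x y : R) : Prop :=
  [/\ a != b,
      forall z, x <= z < y ->
        (gamma T a <= z < mu T a) && (delta T b <= z < nu T b),
      (forall z, gamma T a <= z < mu T a -> x <= z < y) \/
        (forall z, delta T b <= z < nu T b -> x <= z < y),
      forall z, domain T' z <-> domain T z /\ ~~ (x <= z < y) &
      [/\ x < y, ell T <= ell T', right_end T' <= right_end T &
          domain_length T' = domain_length T - (y - x)]].

(** * One induction step: the removed piece, return words, number of letters *)

Section Step.
Variables (R : realType) (A A' : finType) (T : iet R A) (T' : iet R A').
Hypothesis regT : regular T.

Lemma domain_ends u v :
  domain T' = `[u, v[%classic -> ell T' = u /\ right_end T' = v.
Proof.
move=> e; have h z : (ell T' <= z < right_end T') = (u <= z < v).
  have := congr1 (fun X : set R => X z) e; rewrite domainE /= in_itv /= => e'.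
  by apply/idP/idP; rewrite e'.
have lr := ell_lt_right_end T'.
have /andP[h1 h2] : u <= ell T' < v by rewrite -h lexx.
have /andP[h3 h4] : ell T' <= u < right_end T'.
  by rewrite h lexx /=; lra.
split; first by apply/eqP; rewrite eq_le h1 h3.
apply/eqP; rewrite eq_le !leNgt; apply/andP; split; apply/negP => ?.
  by have := h v; rewrite ltxx andbF => /negbT/negP; apply; apply/andP; split; lra.
have := h (right_end T'); rewrite ltxx andbF => /esym/negbT/negP; apply.
by apply/andP; split; lra.
Qed.

Lemma single_letter : ~ (exists c, c != first1 T) -> forall c, c = first1 T.
Proof. by move=> h c; apply/eqP/negPn/negP => hc; apply: h; exists c. Qed.

(** With a single letter [Zdom T] would be empty, unlike any domain. If the last letters of the two
    orders agreed, [T] would fix the left end of that subinterval. *)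
Lemma psi_removes : is_psi T T' ->
  (exists c, c != first1 T) /\ exists a b x y, removes T T' a b x y.
Proof.
case=> /domain_ends[lE rE] _ _.
set a := last1 T in rE; set b := last2 T in rE.
set v := Num.max _ _ in rE.
have mur : mu T a = right_end T by exact: mu_last1.
have nur : nu T b = right_end T by exact: nu_last2.
have lr := ell_lt_right_end T'.
have nt : exists c, c != first1 T.
  apply: contrapT => /single_letter one.
  have vE : v <= ell T.
    rewrite /v ge_max (one a) gamma_first1 lexx.
    by rewrite (one b) -(one (first2 T)) delta_first2 lexx.
  lra.
split=> //; exists a, b, v, (right_end T).
have va : gamma T a <= v by rewrite le_max lexx.
have vb : delta T b <= v by rewrite le_max lexx orbT.
have ga := gamma_lt_mu T a; have db := delta_lt_nu T b.
have vr : v < right_end T by rewrite gt_max; apply/andP; split; lra.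
split.
- apply/eqP => ab; rewrite -ab in nur.
  have /eqP := @regular_no_fixed_point _ _ _ regT (gamma T a) nt
    (gamma_domain T a); apply.
  by rewrite iet_map_gamma /gamma /delta mur nur.
- by rewrite mur nur => z /andP[h1 h2]; rewrite h2 !andbT; apply/andP; split; lra.
- rewrite mur nur; have [e|e] : v = gamma T a \/ v = delta T b.
  + by rewrite /v; case: (leP (gamma T a) (delta T b)) => _; [right|left].
  + by left; rewrite e.
  + by right; rewrite e.
- move=> z; rewrite !domainE lE rE; split.
    by move=> /andP[h1 h2]; rewrite h1 leNgt h2 /=; split=> //; lra.
  by move=> [/andP[h1 h2]]; rewrite h1 h2 andbT -ltNge.
- by rewrite /domain_length; split; lra.
Qed.

Lemma phi_removes : is_phi T T' ->
  (exists c, c != first1 T) /\ exists a b x y, removes T T' a b x y.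
Proof.
case=> /domain_ends[lE rE] _ _.
set a := first1 T in lE; set b := first2 T in lE.
set u := Num.min _ _ in lE.
have gal : gamma T a = ell T by exact: gamma_first1.
have dbl : delta T b = ell T by exact: delta_first2.
have lr := ell_lt_right_end T'.
have nt : exists c, c != first1 T.
  apply: contrapT => /single_letter one.
  have uE : right_end T <= u.
    rewrite /u le_min /a -(one (last1 T)) mu_last1 lexx.
    by rewrite (one b) -(one (last2 T)) nu_last2 lexx.
  lra.
split=> //; exists a, b, (ell T), u.
have ua : u <= mu T a by rewrite ge_min lexx.
have ub : u <= nu T b by rewrite ge_min lexx orbT.
have ga := gamma_lt_mu T a; have db := delta_lt_nu T b.
have lu : ell T < u by rewrite lt_min; apply/andP; split; lra.
split.
- apply/eqP => ab; rewrite -ab in dbl.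
  have /eqP := @regular_no_fixed_point _ _ _ regT (gamma T a) nt
    (gamma_domain T a); apply.
  by rewrite iet_map_gamma dbl gal.
- by rewrite gal dbl => z /andP[h1 h2]; rewrite h1 /=; apply/andP; split; lra.
- rewrite gal dbl; have [e|e] : u = mu T a \/ u = nu T b.
  + by rewrite /u; case: (leP (mu T a) (nu T b)) => _; [left|right].
  + by left; rewrite e.
  + by right; rewrite e.
- move=> z; rewrite !domainE lE rE; split.
    by move=> /andP[h1 h2]; rewrite h2 andbT ltNge h1 andbF; split=> //; lra.
  by move=> [/andP[h1 h2]]; rewrite h1 h2 andbT -leNgt.
- by rewrite /domain_length; split; lra.
Qed.

Variables (a b : A) (x y : R).
Hypothesis rem : removes T T' a b x y.
Hypothesis ind : is_induced T (domain T') T'.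

Lemma removes_subdomain z : domain T' z -> domain T z.
Proof. by case: rem => _ _ _ domE _ /domE[]. Qed.

Lemma removes_first_return z : domain T' z ->
  exists n, first_return T (domain T') z n.
Proof. by case: ind => _ ret _ /ret[n [rn _]]; exists n. Qed.

(** The letter for [T'] determines the return itinerary, whose first entry is the letter for [T]. *)
Lemma letter_refine z w : domain T' z -> domain T' w ->
  letter T' z = letter T' w -> letter T z = letter T w.
Proof.
move=> dz dw e; have [m hm] := removes_first_return dz.
have [n hn] := removes_first_return dw.
have [m0 _ _] := hm; have [n0 _ _] := hn.
case: ind => _ _ /(_ z w m n dz dw hm hn)[/(_ e) + _].
by rewrite -(prednK m0) -(prednK n0) => -[].
Qed.

Lemma first_return1 z : domain T' (iet_map T z) ->
  first_return T (domain T') z 1.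
Proof. by move=> h; split=> //; case. Qed.

Lemma induced_map_eq z : domain T' z -> domain T' (iet_map T z) ->
  iet_map T' z = iet_map T z.
Proof.
move=> dz dTz; case: ind => _ /(_ _ dz)[n [[n0 _ min] ->]] _.
by case: n n0 min => [//|[//|n]] _ /(_ 1%N isT).
Qed.

Lemma removed_image z : domain T' z -> ~ domain T' (iet_map T z) ->
  (x <= iet_map T z < y) /\ letter T z = Some b.
Proof.
move=> dz nd; case: rem => _ sub _ domE _.
have dTz := iet_map_domain (removes_subdomain dz).
have h : x <= iet_map T z < y.
  by apply: contrapT => /negP h; apply: nd; apply/domE.
split=> //; apply/letterP; have /andP[_] := sub _ h.
exact: iet_map_image_inv (removes_subdomain dz).
Qed.

(** The removed piece lies in I_a, so its points go next to J_a; this is disjoint from J_b, which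
    contains the piece, so they leave it at once. *)
Lemma first_return2 z : domain T' z -> ~ domain T' (iet_map T z) ->
  first_return T (domain T') z 2 /\
  itinerary T z 2 = [:: Some b; Some a].
Proof.
move=> dz nd; have [h lb] := removed_image dz nd.
case: (rem) => ab sub _ domE _; have /andP[ha _] := sub _ h.
split; last by rewrite /itinerary /= lb; congr [:: _; _]; apply/letterP.
split=> //= [|[|[|k]]//].
apply/domE; split; first exact/iet_map_domain/iet_map_domain/removes_subdomain.
apply/negP => /sub/andP[_ hb]; move/eqP: ab; apply.
by apply: image_subinterval_uniq hb; exact: iet_map_image.
Qed.

(** Sharing a letter with [z], the points [u] and [v] also return by the word [b a]. Hence [T]
    translates both by the same amount into [[x, y[]. *)
Lemma map_change_short z u v :
  domain T' z -> domain T' u -> domain T' v ->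
  letter T' u = letter T' z -> letter T' v = letter T' z ->
  iet_map T' z != iet_map T z -> v - u < y - x.
Proof.
move=> dz du dv eu ev chg.
have nz : ~ domain T' (iet_map T z).
  by move=> h; rewrite induced_map_eq ?eqxx in chg.
have [rz iz] := first_return2 dz nz.
have image w : domain T' w -> letter T' w = letter T' z ->
    (x <= iet_map T w < y) /\ letter T w = Some b.
  move=> dw ew; apply: removed_image => // /first_return1 rw1.
  by case: ind => _ _ /(_ _ _ _ _ dw dz rw1 rz)[/(_ ew)]; rewrite iz.
have [/andP[u1 u2] lu] := image u du eu.
have [/andP[v1 v2] lv] := image v dv ev.
have := letter_eq_map (removes_subdomain du) (etrans lu (esym lv)).
lra.
Qed.

(* The itineraries of first return are the words [c] and the word [b a]; the
   latter takes the place of the word [b] or [a] that no longer occurs. *)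
Lemma removes_card : (#|A'| <= #|A|)%N.
Proof.
case: (rem) => ab sub full domE _.
have dg := gamma_domain T'.
have lg c : letter T' (gamma T' c) = Some c.
  by apply/letterP/gamma_subinterval.
(* If I_a is removed entirely, [d] is [a]: no point of the new domain lies in I_a. If J_b is, [d] is
   [b]: no point of I_b maps into the new domain. So the word [d] is free to encode [b a]. *)
have [d full_d] : exists d, forall z w, domain T' z -> domain T' w ->
    letter T z = Some d -> domain T' (iet_map T z) ->
    ~ domain T' (iet_map T w) -> False.
  case: full => full; [exists a|exists b] => z w dz dw lz dTz nTw.
    by have /domE[_] := dz; rewrite full //; exact/letterP.
  have /domE[_] := dTz; rewrite full //.
  by apply: iet_map_image; apply/letterP.
pose f c := if `[< domain T' (iet_map T (gamma T' c)) >]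
  then letter T (gamma T' c) else Some d.
have f_inj : injective f.
  move=> c c'; rewrite /f.
  suff : f c = f c' -> letter T' (gamma T' c) = letter T' (gamma T' c').
    by rewrite !lg => h /h[].
  rewrite /f; case: asboolP => h; case: asboolP => h'.
  - move=> e; case: ind => _ _ /(_ _ _ _ _ (dg c) (dg c')
      (first_return1 h) (first_return1 h'))[_]; apply.
    by rewrite /itinerary /= e.
  - by move=> e; case: (full_d _ _ (dg c) (dg c') e h h').
  - by move=> /esym e; case: (full_d _ _ (dg c') (dg c) e h' h).
  - move=> _; have [r1 i1] := first_return2 (dg c) h.
    have [r2 i2] := first_return2 (dg c') h'.
    by case: ind => _ _ /(_ _ _ _ _ (dg c) (dg c') r1 r2)[_]; apply; rewrite i1.
have fS c : f c != None.
  rewrite /f; case: asboolP => // _.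
  by have [e /letterP ->] := subinterval_cover (removes_subdomain (dg c)).
pose g c := odflt a (f c).
apply: (@leq_card _ _ g) => c c' e; apply: f_inj; move: e (fS c) (fS c').
by rewrite /g; case: (f c) (f c') => [?|] [?|] //= ->.
Qed.

End Step.

(** Choose [n0] with the most labels attained on [J]. Refinement maps the labels attained at a later
    [n] onto those at [n0], and maximality makes this surjection injective. *)
Lemma refining_labels_stabilize (X : Type) (J : set X) (B : nat -> finType)
    (f : forall n, X -> B n) (s : nat) :
  (forall n, (#|B n| <= s)%N) ->
  (forall n z w, J z -> J w -> f n.+1 z = f n.+1 w -> f n z = f n w) ->
  exists n0, forall n z w, (n0 <= n)%N -> J z -> J w ->
    f n0 z = f n0 w -> f n z = f n w.
Proof.
move=> Bs fine_step; pose S n := [set b : B n | `[< exists2 z, J z & f n z = b >] ]%SET.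
have S_f n z : J z -> f n z \in S n.
  by move=> Jz; rewrite inE; apply/asboolP; exists z.
pose P k := `[< exists n, #|S n| = k >].
have exP : exists k, P k by exists #|S 0|; apply/asboolP; exists 0%N.
have boundP k : P k -> (k <= s)%N.
  by move=> /asboolP[n <-]; exact: leq_trans (max_card _) (Bs n).
case: (ex_maxnP exP boundP) => k /asboolP[n0 Sn0] maxk.
exists n0 => n z w n0n Jz Jw e.
have refine_to z' w' : J z' -> J w' -> f n z' = f n w' -> f n0 z' = f n0 w'.
  move: (n) n0n; elim=> [|m IH]; first by rewrite leqn0 => /eqP ->.
  rewrite leq_eqVlt ltnS => /orP[/eqP ->//|/IH h] Jz' Jw' e'.
  by apply: h => //; exact: fine_step.
pose g b := if pselect (exists2 z', J z' & f n z' = b) is left ex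
  then f n0 (sval (cid2 ex)) else f n0 z.
have gf z' : J z' -> g (f n z') = f n0 z'.
  move=> Jz'; rewrite /g; case: pselect => [ex|[]]; last by exists z'.
  by case: (cid2 ex) => v Jv ev /=; exact: refine_to.
have gS : (g @: S n)%SET = S n0.
  apply/setP => c; apply/imsetP/idP => [[b]|].
    by rewrite inE => /asboolP[v Jv <-] ->; rewrite gf //; exact: S_f.
  by rewrite inE => /asboolP[v Jv <-]; exists (f n v); rewrite ?gf ?S_f.
have /imset_injP g_inj : #|(g @: S n)%SET| == #|S n|.
  by rewrite eqn_leq leq_imset_card gS Sn0 maxk //; apply/asboolP; exists n.
by apply: g_inj; rewrite ?S_f ?gf.
Qed.

(** Subintervals contain their left but not their right end, so there is always room to the
    right. *)
Lemma letter_right_nbhd (R : realType) (A : finType) (T : iet R A) z t :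
  domain T z -> z < t -> exists2 w, z < w < t & letter T w = letter T z.
Proof.
move=> /subinterval_cover[c hc] zt; case/andP: (hc) => hc1 hc2.
pose m := Num.min (mu T c) t.
have zm : z < m by rewrite lt_min hc2.
have m1 : m <= mu T c by rewrite ge_min lexx.
have m2 : m <= t by rewrite ge_min lexx orbT.
exists ((z + m) / 2); first by apply/andP; split; lra.
move/letterP: (hc) => ->; apply/letterP; apply/andP; split; lra.
Qed.

(** * Sequences of induction steps *)

Section Sequence.
Variables (R : realType) (A : nat -> finType) (T : forall n, iet R (A n)).
Hypothesis regT : forall n, regular (T n).
Hypothesis stepT : forall n, is_phi (T n) (T n.+1) \/ is_psi (T n) (T n.+1).

Lemma step_removes n : (exists c, c != first1 (T n)) /\
  exists a b x y, removes (T n) (T n.+1) a b x y.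
Proof.
by case: (stepT n) => h; [apply: phi_removes|apply: psi_removes].
Qed.

Lemma step_induced n : is_induced (T n) (domain (T n.+1)) (T n.+1).
Proof. by case: (stepT n) => -[e ? ?]; split=> //; rewrite e. Qed.

Lemma step_shrinks n : [/\ ell (T n) <= ell (T n.+1),
  right_end (T n.+1) <= right_end (T n) &
  domain_length (T n.+1) < domain_length (T n)].
Proof.
have [_ [a [b [x [y [_ _ _ _ [xy h1 h2 h3]]]]]]] := step_removes n.
by split=> //; lra.
Qed.

Lemma card_letters n : (#|A n| <= #|A 0|)%N.
Proof.
elim: n => // n; apply: leq_trans.
have [_ [a [b [x [y rem]]]]] := step_removes n.
exact: removes_card rem (step_induced n).
Qed.

(** * The limit interval [[l, r[] common to all domains *)

Section LimitInterval.
Variables l r : R.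
Hypothesis ell_le : forall n, ell (T n) <= l.
Hypothesis right_end_ge : forall n, r <= right_end (T n).
Hypothesis length_lim : forall e, 0 < e ->
  exists N, forall n, (N <= n)%N -> domain_length (T n) < r - l + e.

Lemma limit_domain n z : l <= z < r -> domain (T n) z.
Proof.
move=> /andP[h1 h2]; rewrite domainE.
have := ell_le n; have := right_end_ge n; move=> *; apply/andP; split; lra.
Qed.

(** A domain reaching a fixed distance beyond [l] or [r] is eventually too long. The value [r] stays
    possible, since every right end may exceed [r]. *)
Lemma limit_interval_sup N z :
  (forall n, (N <= n)%N -> domain (T n) z) -> l <= z <= r.
Proof.
move=> h; apply/andP; split; rewrite leNgt; apply/negP => lt.
  have [|M hM] := @length_lim (l - z); first lra.
  have := h _ (leq_maxl N M); rewrite domainE => /andP[+ _].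
  have := hM _ (leq_maxr N M); have := right_end_ge (maxn N M).
  by rewrite /domain_length; lra.
have [|M hM] := @length_lim (z - r); first lra.
have := h _ (leq_maxl N M); rewrite domainE => /andP[_].
have := hM _ (leq_maxr N M); have := ell_le (maxn N M).
by rewrite /domain_length; lra.
Qed.

(** Once the letters have stabilized on [[l, r[], each class met there has positive width, while a
    change of the map on it needs a longer removed piece. *)
Lemma eventually_constant_map : exists n1, forall n z,
  (n1 <= n)%N -> l <= z < r -> iet_map (T n) z = iet_map (T n1) z.
Proof.
have [n0 stable] : exists n0, forall n z w, (n0 <= n)%N ->
    l <= z < r -> l <= w < r ->
    letter (T n0) z = letter (T n0) w -> letter (T n) z = letter (T n) w.
  apply: (@refining_labels_stabilize _ (fun z => l <= z < r)
    (fun n => option (A n)) (fun n => letter (T n)) #|A 0|.+1).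
    by move=> n; rewrite card_option ltnS card_letters.
  by move=> n z w Jz Jw; exact: (letter_refine (step_induced n)
    (limit_domain _ Jz) (limit_domain _ Jw)).
have ev c : exists N, forall n z, (N <= n)%N -> l <= z < r ->
    letter (T n0) z = Some c -> iet_map (T n.+1) z = iet_map (T n) z.
  have [[u Ju lu]|none] :=
    pselect (exists2 u, l <= u < r & letter (T n0) u = Some c); last first.
    by exists 0%N => n z _ Jz lz; case: none; exists z.
  have /andP[lu1 ur] := Ju.
  (* A second point of the class of [u]: the width [v - u] is the threshold for the removed
     lengths. *)
  have [v /andP[uv vr] lv] := letter_right_nbhd (limit_domain n0 Ju) ur.
  have Jv : l <= v < r by apply/andP; split; lra.
  have [|N hN] := @length_lim (v - u); first lra.
  exists (maxn n0 N) => n z; rewrite geq_max => /andP[n0n Nn] Jz lz.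
  apply/eqP/negPn/negP => chg.
  have [_ [a [b [x [y rem]]]]] := step_removes n.
  have same t : l <= t < r -> letter (T n0) t = Some c ->
      letter (T n.+1) t = letter (T n.+1) z.
    move=> Jt lt; apply: stable => //; [exact: leqW | by rewrite lt lz].
  have := map_change_short rem (step_induced n) (limit_domain _ Jz)
    (limit_domain _ Ju) (limit_domain _ Jv) (same _ Ju lu)
    (same _ Jv (etrans lv lu)) chg.
  (* The new domain still has length at least [r - l], so the removed length is below [v - u]. *)
  have := hN n Nn; case: rem => _ _ _ _ [_ _ _].
  have := ell_le n.+1; have := right_end_ge n.+1; rewrite /domain_length; lra.
have [N hN] := choice ev.
exists (\max_c N c) => n z; set n1 := \max_c N c.
elim: n => [|n IH]; first by rewrite leqn0 => /eqP ->.
rewrite leq_eqVlt => /orP[/eqP <-//|]; rewrite ltnS => n1n Jz.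
rewrite -IH //; have [c /letterP hc] := subinterval_cover (limit_domain n0 Jz).
by apply: hN hc => //; apply: leq_trans n1n; exact: leq_bigmax.
Qed.

(** * Invariance of the limit interval once the map is constant on it *)

Section Invariance.
Variable n1 : nat.
Hypothesis constant_map : forall n z,
  (n1 <= n)%N -> l <= z < r -> iet_map (T n) z = iet_map (T n1) z.

(** The image lies in all later domains, hence in the closed interval. It is not [r], since a point
    slightly to the right with the same letter would then be mapped beyond [r]. *)
Lemma limit_interval_forward z : l <= z < r -> l <= iet_map (T n1) z < r.
Proof.
have closed w : l <= w < r -> l <= iet_map (T n1) w <= r.
  move=> Jw; apply: (@limit_interval_sup n1) => n n1n.
  by rewrite -(constant_map n1n Jw); exact/iet_map_domain/limit_domain.
move=> Jz; have /andP[lz zr] := Jz.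
have [w /andP[zw wr] lw] := letter_right_nbhd (limit_domain n1 Jz) zr.
have := letter_eq_map (limit_domain n1 Jz) (esym lw).
have /andP[-> _] := closed _ Jz; have /andP[_] : l <= iet_map (T n1) w <= r.
  by apply: closed; apply/andP; split; lra.
rewrite /=; lra.
Qed.

(* If [T w] were in [l, r[ with [w] outside, then [T n] would map points of
   the remainder of its domain to more than [#|A 0|] equidistant points right of
   [T w]. Two of them come from the same subinterval and hence are at most as
   far apart as the remainder is long, which is impossible for large [n]. *)
Lemma limit_interval_backward w : domain (T n1) w ->
  l <= iet_map (T n1) w < r -> l <= w < r.
Proof.
move=> dw /andP[lz zr]; apply/negPn/negP => nJw.
set z := iet_map (T n1) w in lz zr.
have [t wt out] : exists2 t, w < t & forall v, w <= v < t -> ~~ (l <= v < r).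
  have [wl|lw] := ltP w l.
    by exists l => // v /andP[_ vl]; rewrite leNgt vl.
  exists (w + 1) => [|v /andP[wv _]]; first lra.
  rewrite negb_and -!ltNge -leNgt; apply/orP; right.
  by apply: le_trans wv; rewrite leNgt; move: nJw; rewrite lw.
(* Below [t'] points stay outside [[l, r[], and their translates by [z - w] stay below [r]. *)
pose t' := Num.min t (w + (r - z)).
have t'1 : t' <= t by rewrite ge_min lexx.
have t'2 : t' <= w + (r - z) by rewrite ge_min lexx orbT.
have [|w' /andP[ww' w't'] lw'] := @letter_right_nbhd _ _ _ _ t' dw.
  by rewrite lt_min wt; lra.
have [c hc] := subinterval_cover dw.
have hw' : gamma (T n1) c <= w' < mu (T n1) c.
  by apply/letterP; rewrite lw'; exact/letterP.
have shift s : 0 <= s -> s < w' - w ->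
    [/\ domain (T n1) (w + s), ~~ (l <= w + s < r) &
        iet_map (T n1) (w + s) = z + s].
  move=> s0 s1; have hs : gamma (T n1) c <= w + s < mu (T n1) c.
    by case/andP: hc; case/andP: hw' => *; apply/andP; split; lra.
  split; first exact: subinterval_domain hs.
    by apply: out; apply/andP; split; lra.
  by rewrite /z (iet_mapE hc) (iet_mapE hs); lra.
(* The points [z + i * eta] with [i <= M] are one more than the letters available at any stage. *)
set M := #|A 0|; pose eta := (w' - w) / M.+1%:R.
have eta0 : 0 < eta by rewrite divr_gt0 ?ltr0Sn //; lra.
have etaM : M.+1%:R * eta = w' - w by rewrite mulrC divfK // pnatr_eq0.
have [N hN] := length_lim eta0.
pose n := maxn n1 N.
have pre (i : 'I_M.+1) : exists uc : R * A n,
    [/\ gamma (T n) uc.2 <= uc.1 < mu (T n) uc.2, ~~ (l <= uc.1 < r) &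
        iet_map (T n) uc.1 = z + i%:R * eta].
  have i0 : 0 <= i%:R * eta by rewrite mulr_ge0 ?ler0n // ltW.
  have i1 : i%:R * eta < w' - w by rewrite -etaM ltr_pM2r // ltr_nat.
  have [d1 nJ e1] := shift _ i0 i1.
  have Jzi : l <= z + i%:R * eta < r by apply/andP; split; lra.
  have [u du eu] := iet_map_surj (limit_domain n Jzi).
  have [c' hc'] := subinterval_cover du.
  (* A preimage under [T n] inside [[l, r[] would also be one under [T n1], where injectivity makes
     it [w + i * eta], a point outside. *)
  exists (u, c'); split=> //=; apply: contraNN nJ => Ju.
  suff -> : w + i%:R * eta = u by [].
  apply: (iet_map_inj d1 (limit_domain n1 Ju)).
  by rewrite e1 -eu (constant_map (leq_maxl n1 N) Ju).
have [h hh] := choice pre.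
have lt_letter (i j : 'I_M.+1) : (i < j)%N -> (h i).2 != (h j).2.
  move=> ij; apply/eqP => e; have [hi ni ei] := hh i; have [hj nj ej] := hh j.
  have di := subinterval_domain hi; have dj := subinterval_domain hj.
  move: ei ej; rewrite (iet_mapE hi) (iet_mapE hj) -e => ei ej.
  have diff : (h j).1 - (h i).1 = j%:R * eta - i%:R * eta by lra.
  have gap : eta <= j%:R * eta - i%:R * eta.
    rewrite -mulrBl -natrB; last exact: ltnW.
    by apply: ler_peMl; [exact: ltW|rewrite ler1n subn_gt0].
  have i0 : 0 <= i%:R * eta by rewrite mulr_ge0 ?ler0n // ltW.
  have j1 : j%:R * eta < w' - w by rewrite -etaM ltr_pM2r // ltr_nat.
  have len := hN n (leq_maxr n1 N).
  (* On one side of [[l, r[] the two points are less than [eta] apart. On opposite sides they are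
     more than [r - l] apart, whereas their distance is below [w' - w] and so below [r - z]. *)
  move: di dj ni nj len; rewrite !domainE /domain_length !negb_and -!ltNge -!leNgt.
  have := ell_le n; have := right_end_ge n.
  move=> ? ? /andP[? ?] /andP[? ?] /orP[?|?] /orP[?|?] ?; lra.
have h_inj : injective (fun i => (h i).2).
  move=> i j /eqP e; apply/val_inj; case: (ltngtP i j) => //.
    by move=> /lt_letter; rewrite e.
  by move=> /lt_letter; rewrite eq_sym e.
by have := leq_trans (leq_card _ h_inj) (card_letters n); rewrite card_ord ltnn.
Qed.

End Invariance.

Lemma no_limit_interval : r <= l.
Proof.
rewrite leNgt; apply/negP => lr.
have [n1 constant] := eventually_constant_map.
have inv z : domain (T n1) z ->
    (l <= z < r) = (l <= iet_map (T n1) z < r).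
  move=> dz; apply/idP/idP; first exact: limit_interval_forward.
  exact: limit_interval_backward.
have [nt _] := step_removes n1.
have [_ _] := step_shrinks n1.
have [h|h] := ltP (ell (T n1)) l.
  by move=> _; exact: (regular_no_invariant_subinterval (regT n1) nt h lr
    (right_end_ge n1) inv).
(* The left ends coincide, so the complement [[r, right_end (T n1)[] serves as invariant
   semi-interval; strict shrinking makes it nonempty. *)
have {h}le : ell (T n1) = l by apply/eqP; rewrite eq_le ell_le h.
rewrite /domain_length => shrink.
apply: (@regular_no_invariant_subinterval _ _ _ (regT n1) r (right_end (T n1)))
  => //; first by rewrite le.
  by have := ell_le n1.+1; have := right_end_ge n1.+1; lra.
move=> z dz; have := inv z dz; have := iet_map_domain dz; move: dz.
rewrite !domainE le => /andP[-> ->] /andP[-> ->]; rewrite !andbT /=.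
by rewrite !leNgt => ->.
Qed.

End LimitInterval.
End Sequence.

(** * Convergence of the end points and of the lengths *)

Theorem theorem4p7 (R : realType) (A : nat -> finType)
    (T : forall n : nat, iet R (A n))
    (hreg : forall n : nat, regular (T n))
    (hstep : forall n : nat,
       is_phi (T n) (T n.+1) \/ is_psi (T n) (T n.+1)) :
  domain_length (T n) @[n --> \oo] --> (0 : R).
Proof.
have ell_nd : nondecreasing_seq (fun n => ell (T n)).
  by apply/nondecreasing_seqP => n; case: (step_shrinks hreg hstep n).
have right_ni : nonincreasing_seq (fun n => right_end (T n)).
  by apply/nonincreasing_seqP => n; case: (step_shrinks hreg hstep n).
have ell_cvg : cvgn (fun n => ell (T n)).
  apply: nondecreasing_is_cvgn => //; exists (right_end (T 0)) => _ [n _ <-].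
  by apply: le_trans (right_ni 0%N n isT); exact/ltW/ell_lt_right_end.
have right_cvg : cvgn (fun n => right_end (T n)).
  apply: nonincreasing_is_cvgn => //; exists (ell (T 0)) => _ [n _ <-].
  by apply: le_trans (ell_nd 0%N n isT) _; exact/ltW/ell_lt_right_end.
set l := limn (fun n => ell (T n)) in ell_cvg *.
pose r := limn (fun n => right_end (T n)).
have len_cvg : domain_length (T n) @[n --> \oo] --> r - l by exact: cvgB.
have rl : r <= l.
  apply: (no_limit_interval hreg hstep).
  - by move=> n; exact: nondecreasing_cvgn_le.
  - by move=> n; exact: nonincreasing_cvgn_ge.
  move=> e e0; have : r - l < r - l + e by rewrite ltrDl.
  by move=> /(cvgr_lt _ len_cvg)[N _ hN]; exists N.
have lr : 0 <= r - l.
  rewrite -(cvg_lim _ len_cvg) //; apply: limr_ge; first by apply/cvg_ex; exists (r - l).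
  by apply: nearW => n; rewrite subr_ge0; exact/ltW/ell_lt_right_end.
by have <- : r - l = 0 by lra.
Qed.
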